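(* Let $k\in\mathbb{N}$. For every AAPA $\mathcal{A}$ over $\Sigma$ with $l$ priorities, $n$ directions and $m$ states, there is an alternating parity automaton (APA) over the alphabet $\Sigma^n$ with $\mathcal{O}(l\cdot m\cdot|\Sigma|^{k\cdot n})$ states whose language is exactly the set of words $w\in(\Sigma^n)^\omega$ on which $\mathcal{A}$ has a $k$-synchronous accepting run.
   Context: For a set $Q$, $\mathcal{B}^+(Q)$ denotes positive Boolean formulas over $Q$; a set $Q'\subseteq Q$ satisfies such a formula if it evaluates to true when exactly the elements of $Q'$ are true. An Alternating Asynchronous Parity Automaton (AAPA) with $n$ directions $M=\{1,\dots,n\}$ over a finite alphabet $\Sigma$ is $\mathcal{A}=(Q,\rho_0,\rho,\Omega)$ with finite non-empty $Q$, $\rho_0\in\mathcal{B}^+(Q)$, $\rho:Q\times\Sigma\times M\to\mathcal{B}^+(Q)$, $\Omega:Q\to\{0,\dots,m\}$. It reads $n$ words $w_1,\dots,w_n\in\Sigma^\omega$, identified with the word over $\Sigma^n$ whose $i$-th letter is $(w_1(i),\dots,w_n(i))$. A run is a $Q$-labelled tree $(T,r)$ (every node has at least one child) with offset counters $c_1^t,\dots,c_n^t\in\mathbb{N}_0$ at each node such that $c_i^t=0$ at nodes of depth $\le1$; the labels of the root's children satisfy $\rho_0$; and every non-root node $t$ with children $t_1,\dots,t_k$ has a direction $d$ with $c_d^{t_j}=c_d^t+1$, $c_{d'}^{t_j}=c_{d'}^t$ ($d'\ne d$), $1\le k\le|Q|$, and $\{r(t_1),\dots,r(t_k)\}$ satisfies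 $\rho(r(t),w_d(c_d^t),d)$. A run is accepting if on every infinite path the least priority seen infinitely often is even. A run is $k$-synchronous if at every node $t$ we have $|c_i^t-c_j^t|\le k$ for all $i,j$. An APA over an alphabet $\Gamma$ is $(Q,q_0,\rho,\Omega)$ with $\rho:Q\times\Gamma\to\mathcal{B}^+(Q)$, reading one word $w\in\Gamma^\omega$; a run is a $Q$-labelled tree with root labelled $q_0$ in which the children of a node $t$ (between $1$ and $|Q|$ of them) carry a set of labels satisfying $\rho(r(t),w(|t|))$; it accepts under the same parity condition. *)

(* Defs.v *)
From mathcomp Require Import all_boot all_algebra.
From mathcomp Require Import boolp classical_sets functions cardinality.

Set Implicit Arguments.
Unset Strict Implicit.
Unset Printing Implicit Defensive.

Local Open Scope classical_set_scope.
Local Open Scope card_scope.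

(* As is usual for alternating automata, the constants true and false are
   positive Boolean formulas. *)
Inductive pbform (Q : Type) : Type :=
  | PTrue
  | PFalse
  | PAtom of Q
  | PAnd of pbform Q & pbform Q
  | POr of pbform Q & pbform Q.

Arguments PTrue {Q}.
Arguments PFalse {Q}.

Fixpoint satisfies (Q : Type) (X : set Q) (phi : pbform Q) : Prop :=
  match phi with
  | PTrue => True
  | PFalse => False
  | PAtom q => X q
  | PAnd phi1 phi2 => satisfies X phi1 /\ satisfies X phi2
  | POr phi1 phi2 => satisfies X phi1 \/ satisfies X phi2
  end.

(* A Q-labelled tree without leaves; nodes are finite words over nat, and the
   labelling is relevant on nodes only. *)
Record ltree (Q : Type) := LTree {
  node : set (seq nat);
  label : seq nat -> Q;
  node_nil : node [::];
  node_prefix : forall t j, node (rcons t j) -> node t;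
  node_child : forall t, node t -> exists j, node (rcons t j)
}.

Definition children (Q : Type) (T : ltree Q) (t : seq nat) : set (seq nat) :=
  [set s | node T s /\ exists j, s = rcons t j].

(* The infinite path visiting [::], [:: b 0], [:: b 0; b 1], etc. *)
Definition infinite_path (Q : Type) (T : ltree Q) (b : nat -> nat) : Prop :=
  forall i, node T (mkseq b i).

Definition infinitely_often (p : nat -> nat) (x : nat) : Prop :=
  forall N, exists2 i, N <= i & p i = x.

Definition parity_condition (p : nat -> nat) : Prop :=
  exists x, [/\ ~~ odd x, infinitely_often p x &
    forall y, infinitely_often p y -> x <= y].

Definition accepting_tree (Q : Type) (Omega : Q -> nat) (T : ltree Q) : Prop :=
  forall b, infinite_path T b ->
    parity_condition (fun i => Omega (label T (mkseq b i))).

Record AAPA (Sigma : finType) (n : nat) := MkAAPA {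
  aa_state : finType;
  aa_nonempty : 0 < #|aa_state|;
  aa_init : pbform aa_state;
  aa_trans : aa_state -> Sigma -> 'I_n -> pbform aa_state;
  aa_maxprio : nat;
  aa_prio : aa_state -> 'I_aa_maxprio.+1
}.

(* The number of distinct priorities in use, which is at most
   (aa_maxprio A).+1. *)
Definition aa_num_prios (Sigma : finType) (n : nat) (A : AAPA Sigma n) : nat :=
  #|codom (@aa_prio _ _ A)|.

(* The i-th letter of the word w_d is tnth (w i) d. The offset counters of a
   run are given by c; they are relevant on nodes only. *)
Definition aa_run (Sigma : finType) (n : nat) (A : AAPA Sigma n)
    (w : nat -> n.-tuple Sigma) (T : ltree (aa_state A))
    (c : seq nat -> 'I_n -> nat) : Prop :=
  [/\ forall t, node T t -> size t <= 1 -> forall i, c t i = 0,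
      satisfies (label T @` children T [::]) (aa_init A) &
      forall t, node T t -> t <> [::] -> exists d : 'I_n,
        [/\ forall s, children T t s -> c s d = (c t d).+1,
            forall s, children T t s -> forall d', d' <> d -> c s d' = c t d',
            children T t #<= `I_#|aa_state A| &
            satisfies (label T @` children T t)
              (aa_trans (label T t) (tnth (w (c t d)) d) d)]].

Definition aa_accepting (Sigma : finType) (n : nat) (A : AAPA Sigma n)
    (T : ltree (aa_state A)) : Prop :=
  accepting_tree (fun q => aa_prio q : nat) T.

Definition synchronous (Q : Type) (n k : nat) (T : ltree Q)
    (c : seq nat -> 'I_n -> nat) : Prop :=
  forall t, node T t -> forall i j, `|c t i - c t j|%N <= k.

Definition aa_sync_language (Sigma : finType) (n : nat) (A : AAPA Sigma n)
    (k : nat) : set (nat -> n.-tuple Sigma) :=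
  [set w | exists T c,
     [/\ @aa_run _ _ A w T c, aa_accepting T & synchronous k T c]].

Record APA (Gamma : finType) := MkAPA {
  ap_state : finType;
  ap_init : ap_state;
  ap_trans : ap_state -> Gamma -> pbform ap_state;
  ap_maxprio : nat;
  ap_prio : ap_state -> 'I_ap_maxprio.+1
}.

Definition ap_run (Gamma : finType) (B : APA Gamma) (w : nat -> Gamma)
    (T : ltree (ap_state B)) : Prop :=
  label T [::] = ap_init B /\
  forall t, node T t ->
    children T t #<= `I_#|ap_state B| /\
    satisfies (label T @` children T t) (ap_trans (label T t) (w (size t))).

Definition ap_accepting (Gamma : finType) (B : APA Gamma)
    (T : ltree (ap_state B)) : Prop :=
  accepting_tree (fun q => ap_prio q : nat) T.

Definition ap_language (Gamma : finType) (B : APA Gamma) : set (nat -> Gamma) :=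
  [set w | exists2 T, @ap_run _ B w T & ap_accepting T].

(* Main.v *)
(* The simulating automaton reads its p-th letter when the minimal counter of
   the AAPA is p.  It remembers the state, the offsets of the counters from p
   (at most k each) and the least priority since the last letter, and plays in
   one transition all steps that the AAPA makes until the minimal counter is
   p + 1.  A letter that lies ahead of position p is not available yet: it is
   guessed, and alternation lets a separate copy verify the guess later.  So no
   letters have to be buffered: l m (k+1)^n + n k |Sigma| + 2 states suffice,
   which is at most 4 l m |Sigma|^(k n) as soon as |Sigma| > 1.  If
   |Sigma^n| <= 1, there is only one word and one state is enough. *)

Require Import Defs.
From mathcomp Require Import all_boot.
From mathcomp Require Import boolp classical_sets cardinality.
From mathcomp Require Import zify.

Set Implicit Arguments.
Unset Strict Implicit.
Unset Printing Implicit Defensive.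

(** * The parity condition *)

Definition eventually_ge (p : nat -> nat) (x : nat) : Prop :=
  exists N, forall i, N <= i -> x <= p i.

(** The least value seen infinitely often is the greatest eventual lower bound. In this form the
    condition transfers easily between sequences that run at different speeds. *)
Lemma parity_conditionE (p : nat -> nat) :
  parity_condition p <->
  exists x, [/\ ~~ odd x, eventually_ge p x & ~ eventually_ge p x.+1].
Proof.
split=> [[x [xev xio xmin]]|[x [xev [N hN] xn]]]; exists x; split=> //.
(* A bound [y < x] can be raised by one, because [y] itself occurs only finitely often. *)
- suff H y : y <= x -> eventually_ge p y by exact: H.
  elim: y => [|y IHy] yx; first by exists 0.
  have [N hN] := IHy (ltnW yx).
  have /existsNP[N' hN'] : ~ infinitely_often p y.
    by move=> /xmin; rewrite leqNgt yx.
  exists (maxn N N') => i; rewrite geq_max => /andP[Ni N'i].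
  rewrite ltn_neqAle hN // andbT; apply/eqP => pi.
  by apply: hN'; exists i.
- by move=> [N hN]; have [i Ni pix] := xio N; have := hN i Ni; rewrite pix ltnn.
- move=> N'; apply: contrapT => hn; apply: xn.
  exists (maxn N N') => i; rewrite geq_max => /andP[Ni N'i].
  rewrite ltn_neqAle hN // andbT; apply/eqP => pi.
  by apply: hn; exists i.
- by move=> y /(_ N)[i Ni <-]; exact: hN.
Qed.

(** Equivalently, the limit inferior of [f] is at most that of [h]. The indices are decoupled
    because many steps of the AAPA may correspond to one letter. *)
Definition dominated (f h : nat -> nat) : Prop :=
  forall N, exists M, forall j, M <= j -> exists2 i, N <= i & f i <= h j.

Lemma dominated_eventually_ge (f h : nat -> nat) (x : nat) :
  dominated f h -> eventually_ge f x -> eventually_ge h x.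
Proof.
move=> fh [N hN]; have [M hM] := fh N; exists M => j /hM[i Ni].
by apply: leq_trans; exact: hN.
Qed.

Lemma dominated_parity (f h : nat -> nat) :
  dominated f h -> dominated h f -> parity_condition f -> parity_condition h.
Proof.
move=> fh hf /parity_conditionE[x [xev xf xnf]].
apply/parity_conditionE; exists x; split=> //.
- exact: dominated_eventually_ge xf.
- by move/(dominated_eventually_ge hf).
Qed.

Lemma parity_condition_shift (m : nat) (p : nat -> nat) :
  parity_condition (fun i => p (m + i)) <-> parity_condition p.
Proof.
have H1 : dominated (fun i => p (m + i)) p.
  move=> N; exists (m + N) => j mj; exists (j - m); first by lia.
  by rewrite subnKC //; lia.
have H2 : dominated p (fun i => p (m + i)).
  by move=> N; exists N => j Nj; exists (m + j) => //; lia.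
by split; exact: dominated_parity.
Qed.

(** * Positive formulas in disjunctive normal form *)

Definition pbconj (Q : Type) (s : seq Q) : pbform Q :=
  foldr (fun q => PAnd (PAtom q)) PTrue s.

Lemma satisfies_pbconj (Q : eqType) (Y : set Q) (s : seq Q) :
  satisfies Y (pbconj s) <-> ([set` s] `<=` Y)%classic.
Proof.
elim: s => [|q s IHs] /=; first by split.
split=> [[Yq /IHs sY] p /=|sY].
  by rewrite inE => /predU1P[->|/sY].
split; first by apply: sY; rewrite /= mem_head.
by apply/IHs => p /= ps; apply: sY; rewrite /= inE ps orbT.
Qed.

(** Allows transitions to be specified semantically, by an upward closed property of sets of
    states. *)
Definition pbdnf (Q : finType) (P : set Q -> Prop) : pbform Q :=
  foldr (fun X : {set Q} => POr (pbconj (enum X))) PFalse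
    [seq X : {set Q} <- enum {set Q} | `[< P [set` X]%classic >]].

Lemma satisfies_pbdnf (Q : finType) (P : set Q -> Prop) (Y : set Q) :
  (forall X Z, (X `<=` Z)%classic -> P X -> P Z) ->
  satisfies Y (pbdnf P) <-> P Y.
Proof.
move=> Pmono.
suff H (l : seq {set Q}) :
    satisfies Y (foldr (fun X : {set Q} => POr (pbconj (enum X))) PFalse l) <->
    exists2 X : {set Q}, X \in l & ([set` X] `<=` Y)%classic.
  rewrite H; split=> [[X]|PY].
    by rewrite mem_filter => /andP[/asboolP PX _] XY; exact: Pmono PX.
  have YE : [set` [set q | `[< Y q >]]%SET]%classic = Y.
    by apply/seteqP; split=> q /=; rewrite inE => /asboolP.
  exists [set q | `[< Y q >]]%SET; last by rewrite YE.
  by rewrite mem_filter mem_enum andbT; apply/asboolP; rewrite YE.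
elim: l => [|X l IHl] /=; first by split=> // -[].
split=> [[/satisfies_pbconj XY|/IHl[Z Zl ZY]]|[Z]].
- exists X; first exact: mem_head.
  by move=> q /= qX; apply: XY; rewrite /= mem_enum.
- by exists Z => //; rewrite inE Zl orbT.
- rewrite inE => /predU1P[-> XY|Zl ZY]; last by right; apply/IHl; exists Z.
  by left; apply/satisfies_pbconj => q /=; rewrite mem_enum; exact: XY.
Qed.

(** * Labelled trees *)

Lemma mkseqS (T : Type) (b : nat -> T) (i : nat) :
  mkseq b i.+1 = rcons (mkseq b i) (b i).
Proof. by rewrite /mkseq -addn1 iotaD map_cat cats1. Qed.

Lemma take_node (Q : Type) (T : ltree Q) (t : seq nat) (i : nat) :
  node T t -> node T (take i t).
Proof.
elim/last_ind: t => [|t j IHt] //= h.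
have [it|it] := leqP i (size t).
  by rewrite -cats1 takel_cat //; apply: IHt; exact: node_prefix h.
by rewrite take_oversize // size_rcons.
Qed.

(* A system of labelled positions unravels to a tree: at each node one successor
   is chosen for every label that occurs among the successors. *)
Section Unravelling.
Variables (Q : finType) (N : Type) (x0 : N) (lab : N -> Q).
Variables (succ : N -> N -> Prop).

(** A child is numbered by the index of its label in [enum Q], so that no node gets more than [#|Q|]
    children. *)
Let choice_succ (x : N) (j : nat) : option N :=
  if pselect (exists y, succ x y /\ index (lab y) (enum Q) = j) is left h
  then Some (projT1 (cid h)) else None.

Let choice_succP (x y : N) (j : nat) :
  choice_succ x j = Some y -> succ x y /\ index (lab y) (enum Q) = j.
Proof.
rewrite /choice_succ; case: pselect => // h [<-].
by case: (cid h).
Qed.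

Let choice_succ_ex (x y : N) : succ x y ->
  exists2 y', choice_succ x (index (lab y) (enum Q)) = Some y' & lab y' = lab y.
Proof.
move=> xy; case E: (choice_succ x _) => [y'|].
  exists y' => //; have [_ e] := choice_succP E.
  by rewrite -(nth_index (lab y) (mem_enum Q (lab y'))) e nth_index // mem_enum.
by move: E; rewrite /choice_succ; case: pselect => // -[]; exists y.
Qed.

Let walk (t : seq nat) : option N :=
  foldl (fun ox j => obind (choice_succ^~ j) ox) (Some x0) t.

Let walk_rcons (t : seq nat) (j : nat) :
  walk (rcons t j) = obind (choice_succ^~ j) (walk t).
Proof. by rewrite /walk -cats1 foldl_cat. Qed.

(** Satisfaction of a positive formula depends only on the set of labels of the children, so one
    child per label meets both the transition condition and the bound on branching. *)
Lemma unravelling (inv : N -> Prop) :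
  inv x0 -> (forall x y, inv x -> succ x y -> inv y) ->
  (forall x, inv x -> exists y, succ x y) ->
  exists (T : ltree Q) (pos : seq nat -> N),
    [/\ pos [::] = x0,
        forall t, node T t -> inv (pos t) /\ label T t = lab (pos t),
        forall t s, children T t s -> succ (pos t) (pos s),
        forall t, node T t ->
          (label T @` children T t = lab @` succ (pos t))%classic &
        forall t, (children T t #<= `I_#|Q|)%card].
Proof.
move=> inv0 invS succ_ex.
pose pos t := odflt x0 (walk t).
pose nd : set (seq nat) := fun t => walk t <> None.
have walkE t : nd t -> walk t = Some (pos t).
  by rewrite /nd /pos; case: (walk t).
have nd_prefix t j : nd (rcons t j) -> nd t.
  by rewrite /nd walk_rcons; case: (walk t).
have step t j : nd (rcons t j) ->
    choice_succ (pos t) j = Some (pos (rcons t j)).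
  move=> h; have := walkE _ h.
  by rewrite walk_rcons (walkE _ (nd_prefix _ _ h)).
have ndinv t : nd t -> inv (pos t).
  elim/last_ind: t => [//|t j IHt] h.
  have [h1 _] := choice_succP (step _ _ h).
  exact: invS (IHt (nd_prefix _ _ h)) h1.
have nd_succ t y : nd t -> succ (pos t) y ->
    exists j, nd (rcons t j) /\ lab (pos (rcons t j)) = lab y.
  move=> ht /choice_succ_ex[y' h1 h2].
  exists (index (lab y) (enum Q)).
  by rewrite /pos /nd walk_rcons walkE //= h1.
have nd_child t : nd t -> exists j, nd (rcons t j).
  move=> ht; have [y ty] := succ_ex _ (ndinv _ ht).
  by have [j [h _]] := nd_succ _ _ ht ty; exists j.
have nd0 : nd [::] by [].
pose T := LTree (lab \o pos) nd0 nd_prefix nd_child.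
exists T, pos; split=> //.
- by move=> t ht; split=> //; exact: ndinv.
- move=> t s [hs [j sE]]; rewrite sE in hs *.
  by have [] := choice_succP (step _ _ hs).
- move=> t ht; apply/seteqP; split=> [q [s [hs [j sE]] <-]|q [y ty <-]].
    rewrite sE in hs *; exists (pos (rcons t j)) => //.
    by have [] := choice_succP (step _ _ hs).
  have [j [h e]] := nd_succ _ _ ht ty.
  by exists (rcons t j) => //; split=> //; exists j.
- move=> t; apply: card_le_trans (card_image_le (rcons t) _).
  apply: subset_card_le => s [hs [j sE]]; exists j => //=.
  rewrite sE in hs; have [_ <-] := choice_succP (step _ _ hs).
  by rewrite cardE index_mem mem_enum.
Qed.

End Unravelling.

(** * Sequences of levels and chains of prefixes *)

Lemma crossing (g : nat -> nat) (i0 m v : nat) :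
  g i0 <= v -> v < g m -> i0 <= m ->
  exists2 i, i0 <= i & g i <= v < g i.+1.
Proof.
move=> g0 gm /subnKC mE; rewrite -{}mE in gm.
elim: (m - i0) gm => [|r IHr]; first by rewrite addn0; lia.
rewrite addnS => gr; have [vr|vr] := ltnP v (g (i0 + r)); first exact: IHr.
by exists (i0 + r); [lia|rewrite vr].
Qed.

(** The letter at index [j] can be read off from any member longer than [j]; they all agree there,
    since each member is a prefix of the next. *)
Lemma prefix_chain (t : nat -> seq nat) :
  (forall i, take (size (t i)) (t i.+1) = t i) ->
  (forall N, exists i, N <= size (t i)) ->
  exists b, forall i j, j <= size (t i) -> take j (t i) = mkseq b j.
Proof.
move=> tpre tsize.
have tmono i r : take (size (t i)) (t (i + r)) = t i.
  elim: r => [|r IHr]; first by rewrite addn0 take_size.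
  rewrite addnS; rewrite -{2}IHr -(tpre (i + r)) take_takel //.
  by rewrite -[in leqLHS]IHr size_take; case: ifP; lia.
have nthE i i' j : j < size (t i) -> j < size (t i') ->
    nth 0 (t i) j = nth 0 (t i') j.
  wlog le : i i' / i <= i'.
    by move=> H; have [/H//|/ltnW/H{}H] := leqP i i'; move=> ? ?; rewrite H.
  by move=> ji _; rewrite -(tmono i (i' - i)) subnKC // nth_take.
have [r hr] := boolp.choice (fun j => tsize j.+1).
exists (fun j => nth 0 (t (r j)) j) => i j ji.
apply: (@eq_from_nth _ 0); rewrite size_takel // ?size_mkseq // => m mj.
by rewrite nth_take // nth_mkseq // (nthE i (r m)) // (leq_trans mj).
Qed.

(** * The simulating automaton *)

Section SynchronousAutomaton.
Variables (Sigma : finType) (n k : nat) (A : AAPA Sigma n).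
Local Notation Q := (aa_state A).
Local Notation prio q := (nat_of_ord (aa_prio q)).

(** Restricting to the priorities in use makes the factor in the state count [aa_num_prios A] rather
    than [(aa_maxprio A).+1]. *)
Definition used_priority : finType :=
  {p : 'I_(aa_maxprio A).+1 | p \in codom (@aa_prio _ _ A)}.

Definition state_priority (q : Q) : used_priority :=
  exist _ (aa_prio q) (codom_f (@aa_prio _ _ A) q).

Local Notation pval p := (nat_of_ord (val (p : used_priority))).

Definition min_priority (p1 p2 : used_priority) : used_priority :=
  if pval p1 <= pval p2 then p1 else p2.

Lemma min_priorityE (p1 p2 : used_priority) :
  pval (min_priority p1 p2) = minn (pval p1) (pval p2).
Proof. by rewrite /min_priority; case: leqP => h; lia. Qed.

Definition sync_state : finType :=
  (bool + aa_state A * used_priority * {ffun 'I_n -> 'I_k.+1}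
   + 'I_n * 'I_k * Sigma)%type.

Definition init_state : sync_state := inl (inl true).

Definition accept_state : sync_state := inl (inl false).

(* After p letters: A is in state q with counters p + o, and pr is the least
   priority seen while the minimal counter moved from p.-1 to p. *)
Definition main_state (q : Q) (pr : used_priority) (o : 'I_n -> nat) :
    sync_state :=
  inl (inr (q, pr, [ffun e => inord (o e)])).

(* After p letters: the claim that the letter at position p + j of the d-th
   word is b. *)
Definition check_state (d : 'I_n) (j : 'I_k) (b : Sigma) : sync_state :=
  inr (d, j, b).

Definition advance (d : 'I_n) (o : 'I_n -> nat) : 'I_n -> nat :=
  fun e => o e + (e == d).

(* The set Y of successor states suffices to play A from state q with counters
   p + o until the minimal counter is p.+1, where a is the letter of the input
   at position p; letters read further ahead are guessed and checked. *)
Inductive plays (a : n.-tuple Sigma) (Y : set sync_state) :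
    Q -> used_priority -> ('I_n -> nat) -> Prop :=
  | plays_wait q pr o :
      (forall e, 0 < o e) -> Y (main_state q pr (fun e => (o e).-1)) ->
      plays a Y q pr o
  | plays_step q pr o d b X :
      (exists e, o e = 0) ->
      (forall i j, advance d o i <= advance d o j + k) ->
      (if o d is j.+1 then
         exists2 j' : 'I_k, j' = j :> nat & Y (check_state d j' b)
       else tnth a d = b) ->
      (X !=set0)%classic -> satisfies X (aa_trans q b d) ->
      (forall q', X q' ->
         plays a Y q' (min_priority pr (state_priority q')) (advance d o)) ->
      plays a Y q pr o.

Lemma plays_mono (a : n.-tuple Sigma) (Y Z : set sync_state) q pr o :
  (Y `<=` Z)%classic -> plays a Y q pr o -> plays a Z q pr o.
Proof.
move=> YZ; elim=> {q pr o}.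
  by move=> q pr o o_gt0 /YZ; exact: plays_wait.
move=> q pr o d b X o0 osync chk X0 Xsat _ IH.
apply: (plays_step o0 osync _ X0 Xsat IH).
by case: (o d) chk => // j [j' j'E /YZ]; exists j'.
Qed.

(** A play ends only by waiting, which puts a main state into [Y], and every step has some [q'] to
    go on with. *)
Lemma plays_nonempty (a : n.-tuple Sigma) (Y : set sync_state) q pr o :
  plays a Y q pr o -> (Y !=set0)%classic.
Proof.
elim=> {q pr o}; first by move=> q pr o _ Yq; eexists; exact: Yq.
by move=> q pr o d b X _ _ _ [q' Xq'] _ _ /(_ _ Xq').
Qed.

(** Inversion: whether some offset is zero decides which constructor applies. *)
Lemma plays_first_step (a : n.-tuple Sigma) (Y : set sync_state) q pr o :
  plays a Y q pr o -> (exists e, o e = 0) ->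
  exists (d : 'I_n) (b : Sigma) (X : set Q),
    [/\ forall i j, advance d o i <= advance d o j + k,
        (if o d is j.+1 then
           exists2 j' : 'I_k, j' = j :> nat & Y (check_state d j' b)
         else tnth a d = b),
        (X !=set0)%classic, satisfies X (aa_trans q b d) &
        forall q', X q' ->
          plays a Y q' (min_priority pr (state_priority q')) (advance d o)].
Proof.
case=> {q pr o}; first by move=> q pr o h _ [e oe]; have := h e; rewrite oe.
by move=> q pr o d b X _ h1 h2 h3 h4 h5 _; exists d, b, X.
Qed.

Lemma plays_waits (a : n.-tuple Sigma) (Y : set sync_state) q pr o :
  plays a Y q pr o -> (forall e, 0 < o e) ->
  Y (main_state q pr (fun e => (o e).-1)).
Proof.
case=> {q pr o}; first by [].
by move=> q pr o d b X [e oe] _ _ _ _ _ h; have := h e; rewrite oe.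
Qed.

Definition starts (a : n.-tuple Sigma) (Y : set sync_state) : Prop :=
  exists X : set Q, [/\ (X !=set0)%classic, satisfies X (aa_init A) &
    forall q, X q -> plays a Y q (state_priority q) (fun=> 0)].

Definition ord_dec (j : 'I_k) : 'I_k :=
  Ordinal (leq_ltn_trans (leq_pred j) (ltn_ord j)).

Definition sync_trans (s : sync_state) (a : n.-tuple Sigma) :
    pbform sync_state :=
  match s with
  | inl (inl true) => pbdnf (starts a)
  | inl (inl false) => PAtom accept_state
  | inl (inr (q, _, o)) =>
      pbdnf (fun Y => plays a Y q (state_priority q) (fun e => o e))
  | inr (d, j, b) =>
      if 0 < j then PAtom (check_state d (ord_dec j) b)
      else if tnth a d == b then PAtom accept_state else PFalse
  end.

(** Checks and [accept_state] get the even priority 0, so a path that leaves the simulation is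
    accepted unless its check fails. *)
Definition sync_prio (s : sync_state) : 'I_(aa_maxprio A).+1 :=
  if s is inl (inr (_, pr, _)) then val pr else ord0.

Definition sync_apa : APA (n.-tuple Sigma) :=
  MkAPA init_state sync_trans sync_prio.

Lemma satisfies_starts (a : n.-tuple Sigma) (Y : set sync_state) :
  satisfies Y (pbdnf (starts a)) <-> starts a Y.
Proof.
apply: satisfies_pbdnf => {}Y Z YZ [X [X0 Xsat hX]]; exists X; split=> // q /hX.
exact: plays_mono.
Qed.

Lemma satisfies_plays (a : n.-tuple Sigma) (Y : set sync_state) q pr o :
  satisfies Y (pbdnf (fun Y => plays a Y q pr o)) <-> plays a Y q pr o.
Proof. by apply: satisfies_pbdnf => {}Y Z YZ; exact: plays_mono. Qed.

(** * From runs of the AAPA to runs of the simulating automaton *)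

Definition simulating (s : sync_state) : bool :=
  match s with inl (inl false) | inr _ => false | _ => true end.

Section SegmentsOfRuns.
Variables (w : nat -> n.-tuple Sigma) (T : ltree Q).
Variable (c : seq nat -> 'I_n -> nat).

Definition least_priority (lo : nat) (t : seq nat) (v : nat) : Prop :=
  (exists2 i, lo <= i <= size t & prio (label T (take i t)) = v) /\
  (forall i, lo <= i <= size t -> v <= prio (label T (take i t))).

(* The root is excluded from the priorities because its label is arbitrary. *)
Definition segment (t : seq nat) (p : nat) (t' : seq nat)
    (pr : used_priority) : Prop :=
  [/\ node T t', take (size t) t' = t, size t < size t',
      (forall e, p < c t' e) /\ (exists e, c t' e = p.+1) &
      least_priority (maxn 1 (size t)) t' (pval pr)].

Definition position : Type := sync_state * seq nat * nat.

Definition position_valid (x : position) : Prop :=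
  let: (s, t, p) := x in
  match s with
  | inl (inl true) => t = [::] /\ p = 0
  | inl (inl false) => True
  | inl (inr (q, _, o)) =>
      [/\ node T t, t <> [::], label T t = q, forall e, c t e = p + o e &
          exists e, o e = 0 :> nat]
  | inr (d, j, b) => tnth (w (p + j)) d = b
  end.

(* Every true claim is a successor, whether or not the play makes it. *)
Definition position_succ (x y : position) : Prop :=
  let: (s, t, p) := x in
  let: (s', t', p') := y in
  [/\ p' = p.+1, position_valid y &
    match s with
    | inl (inl false) => s' = accept_state
    | inr (d, j, b) =>
        s' = if 0 < j then check_state d (ord_dec j) b else accept_state
    | _ =>
      match s' with
      | inl (inl _) => False
      | inl (inr (_, pr, _)) => segment t p t' pr
      | inr _ => True
      end
    end].

Definition position_state (x : position) : sync_state := x.1.1.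

Hypotheses (n_gt0 : 0 < n) (Trun : aa_run w T c) (Tsync : synchronous k T c).

Lemma counter_le t p e :
  node T t -> (exists e', c t e' <= p) -> c t e <= p + k.
Proof. by move=> ht [e' he']; have := Tsync ht e e'; lia. Qed.

(** The run itself serves as the play, with its own directions, letters and children. The
    disjunction on [t1] ensures that a segment is not empty: at [t] itself some counter still equals
    [p], so a step must precede waiting. *)
Lemma plays_of_run (t : seq nat) (p : nat) (Y : set sync_state) :
  (forall t' pr, segment t p t' pr ->
     Y (main_state (label T t') pr (fun e => c t' e - p.+1))) ->
  (forall d (j : 'I_k) b, tnth (w (p.+1 + j)) d = b -> Y (check_state d j b)) ->
  forall t1 pr, node T t1 -> t1 <> [::] -> take (size t) t1 = t ->
    (size t < size t1) || [exists e, c t1 e == p] ->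
    (forall e, p <= c t1 e) -> (exists e, c t1 e <= p.+1) ->
    least_priority (maxn 1 (size t)) t1 (pval pr) ->
    plays (w p) Y (label T t1) pr (fun e => c t1 e - p).
Proof.
have [_ _ Tstep] := Trun.
move=> Yseg Ycheck t1 pr.
(* While some counter equals [p], synchrony keeps all of them at most [p + k]; the truncated
   differences are then positive and each step lowers the sum. *)
have [m hm] := ubnP (\sum_(e < n) (p + k.+2 - c t1 e)).
elim: m => // m IHm in t1 pr hm *.
move=> ht1 t1n tt1 tlt cge cle lst.
case: (pselect (forall e, p < c t1 e)) => [cgt|/existsNP[e0 he0]].
  apply: plays_wait => [e|]; first by rewrite subn_gt0.
  have -> : (fun e => (c t1 e - p).-1) = (fun e => c t1 e - p.+1).
    by apply/funext => e; rewrite subnS.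
  apply: Yseg; split=> //.
    case/orP: tlt => // /existsP[e /eqP ce].
    by have := cgt e; rewrite ce ltnn.
  by split=> //; have [e he] := cle; exists e; have := cgt e; lia.
have ce0 : c t1 e0 = p by have := cge e0; lia.
have [d [cd cd' _ sat]] := Tstep t1 ht1 t1n.
have adv s : children T t1 s ->
    (fun e => c s e - p) = advance d (fun e => c t1 e - p).
  move=> hs; apply/funext => e; rewrite /advance.
  case: eqP => [->|ne]; first by rewrite (cd _ hs); have := cge d; lia.
  by rewrite (cd' _ hs _ ne) addn0.
have [j0 hj0] := node_child ht1.
have ch0 : children T t1 (rcons t1 j0) by split=> //; exists j0.
apply: (@plays_step _ _ _ _ _ d _ (label T @` children T t1)%classic
  _ _ _ _ sat).
- by exists e0; rewrite ce0 subnn.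
- move=> i j; rewrite -(adv _ ch0).
  have hge i' : p <= c (rcons t1 j0) i'.
    have := cge i'; case: (eqVneq i' d) => [->|/eqP ne].
      by rewrite (cd _ ch0); lia.
    by rewrite (cd' _ ch0 _ ne).
  by have := Tsync ch0.1 i j; have := hge i; have := hge j; lia.
(* The guess is the letter the run really reads. Seen from [p.+1], where its check starts, it lies
   [j] positions ahead. *)
- case E: (c t1 d - p) => [|j].
    by have -> : c t1 d = p by have := cge d; lia.
  have jk : j < k by have := counter_le d ht1 (ex_intro _ e0 (eq_leq ce0)); lia.
  exists (Ordinal jk) => //; apply: Ycheck => /=.
  by have -> : p.+1 + j = c t1 d by lia.
- by exists (label T (rcons t1 j0)); exists (rcons t1 j0).
- move=> q' [s hs <-]; rewrite -(adv _ hs).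
  have [hs1 [j sE]] := hs.
  have ssz : size s = (size t1).+1 by rewrite sE size_rcons.
  have tsz : size t <= size t1.
    by rewrite -tt1 size_take; case: ifP => //; lia.
  have tks i : i <= size t1 -> take i s = take i t1.
    by move=> it; rewrite sE -cats1 takel_cat.
  apply: IHm => //.
  + apply: leq_trans (_ : \sum_(e < n) (p + k.+2 - c t1 e) <= m); last by lia.
    rewrite (bigD1 d) //= [X in _ < X](bigD1 d) //= (cd _ hs).
    have := counter_le d ht1 (ex_intro _ e0 (eq_leq ce0)).
    have -> : \sum_(i < n | i != d) (p + k.+2 - c s i) =
              \sum_(i < n | i != d) (p + k.+2 - c t1 i).
      by apply: eq_bigr => i /eqP ne; rewrite (cd' _ hs _ ne).
    by move=> cdk; rewrite ltn_add2r; lia.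
  + by rewrite sE; case: (t1).
  + by rewrite tks.
  + by rewrite ssz ltnS tsz.
  + move=> e; have := cge e; case: (eqVneq e d) => [->|/eqP ne].
      by rewrite (cd _ hs); lia.
    by rewrite (cd' _ hs _ ne).
  + exists e0; case: (eqVneq e0 d) => [e0d|/eqP ne].
      by rewrite e0d (cd _ hs) -e0d ce0.
    by rewrite (cd' _ hs _ ne) ce0.
  + rewrite min_priorityE; have [[i hi ei] hmin] := lst; split.
      case: (leqP (pval pr) (prio (label T s))) => _.
        by exists i; [lia|rewrite tks //; lia].
      by exists (size s); [lia|rewrite take_size].
    move=> i' hi'; have [it|it] := leqP i' (size t1).
      by rewrite tks //; have := hmin i'; rewrite geq_min; lia.
    have -> : i' = size s by lia.
    by rewrite take_size geq_min leqnn orbT.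
Qed.

Lemma least_priority_child j t :
  t = [:: j] -> least_priority 1 t (pval (state_priority (label T t))).
Proof.
move=> ->; split; first by exists 1.
by move=> i hi; have -> : i = 1 by move: hi => /=; lia.
Qed.

Lemma position_succ_main (t : seq nat) (p : nat) s :
  simulating s ->
  let Y := (position_state @` position_succ (s, t, p))%classic in
  (forall t' pr, segment t p t' pr ->
     Y (main_state (label T t') pr (fun e => c t' e - p.+1))) /\
  (forall d (j : 'I_k) b, tnth (w (p.+1 + j)) d = b -> Y (check_state d j b)).
Proof.
move=> sE; split=> [t' pr hseg|d j b hb]; last first.
  exists (check_state d j b, t, p.+1) => //.
  by case: s sE => [[[]|[[]]]|].
exists (main_state (label T t') pr (fun e => c t' e - p.+1), t', p.+1) => //.
have [ht' _ szt' [cgt [e ce]] _] := hseg.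
(* Some counter is [p.+1] here, so by synchrony the offsets are at most [k] and [inord] loses
   nothing. *)
have oE e' : inord (n' := k) (c t' e' - p.+1) = c t' e' - p.+1 :> nat.
  rewrite inordK //.
  by have := counter_le e' ht' (ex_intro _ e (eq_leq ce)); lia.
have i1 : position_valid
    (main_state (label T t') pr (fun e => c t' e - p.+1), t', p.+1).
  split=> //.
  - by move=> t'0; rewrite t'0 in szt'.
  - by move=> e'; rewrite ffunE oE; have := cgt e'; lia.
  - by exists e; rewrite ffunE oE ce subnn.
by case: s sE => [[[]|[[]]]|].
Qed.

(** Main states follow the run by [plays_of_run]. A true claim stays true when both its distance and
    the remaining word shrink by one, and at distance 0 it agrees with the letter read. *)
Lemma position_succ_sat s t p : position_valid (s, t, p) ->
  satisfies (position_state @` position_succ (s, t, p))%classic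
    (sync_trans s (w p)).
Proof.
have [c0 Tinit _] := Trun.
move: s => [[[]|[[q pr] o]]|[[d j] b]] /=.
- move=> [-> ->]; apply/satisfies_starts.
  exists (label T @` children T [::])%classic; split=> //.
    have [j hj] := node_child (node_nil T).
    exists (label T (rcons [::] j)); exists (rcons [::] j) => //.
    by split=> //; exists j.
  move=> q [s hs <-]; have [hs1 [j sE]] := hs.
  have [h1 h2] := position_succ_main [::] 0 (isT : simulating init_state).
  have -> : (fun=> 0) = (fun e : 'I_n => c s e - 0).
    by apply/funext => e; rewrite c0 // sE.
  apply: (plays_of_run h1 h2) => //.
  + by rewrite sE.
  + by rewrite sE.
  + by rewrite sE size_rcons.
  + by exists (Ordinal n_gt0); rewrite c0 // sE.
  + exact: least_priority_child sE.
- by move=> _; exists (accept_state, t, p.+1).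
- move=> [ht tn lt ce [e oe]]; apply/satisfies_plays.
  have -> : (fun e => nat_of_ord (o e)) = (fun e : 'I_n => c t e - p).
    by apply/funext => e'; rewrite ce addKn.
  rewrite -{2 3}lt.
  have [h1 h2] :=
    position_succ_main t p (isT : simulating (inl (inr (q, pr, o)))).
  apply: (plays_of_run h1 h2) => //.
  + by rewrite take_size.
  + by apply/orP; right; apply/existsP; exists e; rewrite ce oe addn0.
  + by move=> e'; rewrite ce leq_addr.
  + by exists e; rewrite ce oe; lia.
  + have t0 : 0 < size t by case: (t) tn.
    have -> : maxn 1 (size t) = size t by lia.
    split; first by exists (size t); rewrite ?leqnn // take_size.
    move=> i hi; have -> : i = size t by lia.
    by rewrite take_size.
- move=> hb; case: ifP => j0 /=.
    exists (check_state d (ord_dec j) b, t, p.+1) => //.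
    rewrite j0; split=> //=.
    by have -> : p.+1 + j.-1 = p + j by lia.
  have pj : p + j = p by lia.
  rewrite -hb pj eqxx; exists (accept_state, t, p.+1) => //.
  by rewrite /= j0; split.
Qed.

(** No transition formula of the simulating automaton is satisfied by the empty set. *)
Lemma position_succ_ex x :
  position_valid x -> exists y, position_succ x y.
Proof.
case: x => [[s t] p] /position_succ_sat.
suff H : satisfies (position_state @` position_succ (s, t, p))%classic
   (sync_trans s (w p)) ->
   (position_state @` position_succ (s, t, p) !=set0)%classic.
  by move=> /H[_ [y hy _]]; exists y.
move: s => [[[]|[[q pr] o]]|[[d j] b]].
- by move/satisfies_starts => [X [[q Xq] _ /(_ _ Xq)]]; exact: plays_nonempty.
- by move=> h; exists accept_state.
- by move/satisfies_plays; exact: plays_nonempty.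
- rewrite /=; case: ifP => _ /=; first by move=> h; eexists; exact: h.
  by case: ifP => //= _ h; eexists; exact: h.
Qed.

End SegmentsOfRuns.

(** The valid positions unravel to a run. A path either leaves the simulation and sees only priority
    0 from then on, or traces a path of [T] cut into segments, whose minima have the same limit
    inferior as the priorities on that path. *)
Lemma sync_language_sub (w : nat -> n.-tuple Sigma) : 0 < n ->
  aa_sync_language A k w -> ap_language sync_apa w.
Proof.
move=> n_gt0 [T [c [Trun Tacc Tsync]]].
pose inv := position_valid w T c.
pose succ := position_succ w T c.
have succ_inv x y : inv x -> succ x y -> inv y.
  by case: x => [[s t] p]; case: y => [[s' t'] p'] _ [].
have inv0 : inv (init_state, [::], 0) by [].
have [T' [pos [pos0 hT' psucc plab pcard]]] :=
  unravelling position_state inv0 succ_inv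
    (position_succ_ex n_gt0 Trun Tsync).
exists T'.
  split; first by have [_ ->] := hT' _ (node_nil T'); rewrite pos0.
  move=> t ht; split; first exact: pcard.
  (* The letter count stored in a position is the depth, so the run reads the right letter. *)
  have szt : (pos t).2 = size t.
    elim/last_ind: t ht => [|t j IHt] ht; first by rewrite pos0.
    have ht' := node_prefix ht.
    have := psucc t (rcons t j) (conj ht (ex_intro _ j erefl)).
    rewrite size_rcons -IHt //.
    by case: (pos t) => [[s ?] p]; case: (pos _) => [[s' ?] p'] [].
  have [hinv ->] := hT' t ht.
  rewrite plab // -szt.
  by case: (pos t) hinv => [[s t'] p]; exact: position_succ_sat.
move=> b hb.
pose x i := pos (mkseq b i).
have xsucc i : succ (x i) (x i.+1).
  apply: psucc; rewrite mkseqS; split; last by exists (b i).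
  by rewrite -mkseqS; exact: hb.
have labE i : label T' (mkseq b i) = position_state (x i).
  by have [] := hT' _ (hb i).
under [X in parity_condition X]funext do rewrite labE.
case: (pselect (forall i, simulating (x i).1.1)) => [sim|/existsNP[i0 hi0]];
    last first.
  have nsim i : ~~ simulating (x (i0 + i)).1.1.
    elim: i => [|i IHi]; first by rewrite addn0; exact/negP.
    have := xsucc (i0 + i); rewrite addnS; move: IHi.
    case: (x _) => [[s t] p]; case: (x _) => [[s' t'] p'] /=.
    case: s => [[[]|[[q pr] o]]|[[d j] b']] //= _ [_ _ ->] //.
    by case: ifP.
  apply/(parity_condition_shift i0); exists 0; split=> //.
  move=> N; exists N => //; have := nsim N.
  by case: (x _) => [[[[[]|[[]]]|] t] p].
pose tt i := (x i).1.2.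
have xseg i : exists q pr o, (x i.+1).1.1 = inl (inr (q, pr, o)) /\
    segment T c (tt i) (x i).2 (tt i.+1) pr.
  rewrite /tt; have := sim i.+1; have := sim i; have := xsucc i.
  case: (x i) => [[s t] p]; case: (x i.+1) => [[s' t'] p'] /=.
  case: s' => [[[]|[[q pr] o]]|[[d j] b']] //= [_ _ h] hs _.
    by case: s hs h => [[[]|[[? ?] ?]]|[[? ?] ?]].
  by exists q, pr, o; case: s hs h => [[[]|[[? ?] ?]]|[[? ?] ?]].
have ttpre i : take (size (tt i)) (tt i.+1) = tt i.
  by have [q [pr [o [_ []]]]] := xseg i.
have ttlt i : size (tt i) < size (tt i.+1).
  by have [q [pr [o [_ []]]]] := xseg i.
have ttge i : i <= size (tt i).
  by elim: i => // i IHi; exact: leq_ltn_trans (ttlt i).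
have [b' hb'] := prefix_chain ttpre (fun N => ex_intro _ N (ttge N)).
have ttnode i : node T (tt i.+1).
  by have [q [pr [o [_ []]]]] := xseg i.
have path' : infinite_path T b'.
  move=> i; rewrite -(hb' i.+1); first exact: take_node.
  by apply: leq_trans (ttge _).
have leastP i : least_priority T (maxn 1 (size (tt i))) (tt i.+1)
    (sync_prio (x i.+1).1.1).
  by have [q [pr [o [-> []]]]] := xseg i.
apply: dominated_parity (Tacc b' path').
(* The minimum of a segment is attained at a node inside it, of depth at least [j]. *)
- move=> N; exists N.+1 => j; case: j => // j Nj.
  have [[i hi /= <-] _] := leastP j.
  by exists i; [have := ttge j; lia|rewrite -(hb' j.+1) //; lia].
(* Conversely, every late node of the path lies in a late segment, whose minimum bounds its priority
   from below. *)
- move=> N; exists (size (tt N)).+1 => i hi.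
  have [j Nj hj] : exists2 j, N <= j & size (tt j) <= i < size (tt j.+1).
    apply: (crossing (m := i.+1) (g := fun j => size (tt j))).
    - by lia.
    - exact: ttge.
    - by have := ttge N; lia.
  exists j.+1; first by lia.
  have [_ h] := leastP j; rewrite -(hb' j.+1); last by lia.
  by apply: h; lia.
Qed.

(** * From runs of the simulating automaton to runs of the AAPA *)

(** Each letter read lowers the distance by one; at distance 0 a false claim meets [PFalse], which
    no run can satisfy. *)
Lemma check_run (w : nat -> n.-tuple Sigma) (T : ltree sync_state) d j b t :
  ap_run (B := sync_apa) w T -> node T t -> label T t = check_state d j b ->
  tnth (w (size t + j)) d = b.
Proof.
move=> [_ hT].
have [m] := ubnP (j : nat); elim: m => // m IHm in j t *.
move=> jm ht tE; have [_] := hT t ht; rewrite tE /=; case: ifP => j0 /=.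
  move=> [s [hs [i sE]] /(IHm _ _ _ hs)] /=.
  rewrite sE size_rcons => <- //; last by lia.
  by congr (tnth (w _) _); lia.
by have -> : j = 0 :> nat by [lia]; rewrite addn0; case: eqP.
Qed.

(* tt i is the node of the tree of the simulating automaton reached after i
   steps of A, and pr i the least priority of A seen since it was entered. *)
Lemma segment_minima_parity (T : ltree sync_state) (tt : nat -> seq nat)
    (qq : nat -> Q) (pr : nat -> used_priority) :
  ap_accepting (B := sync_apa) T -> (forall i, node T (tt i)) ->
  tt 0 = [::] -> pr 0 = state_priority (qq 0) ->
  (forall i,
      tt i.+1 = tt i /\
      pr i.+1 = min_priority (pr i) (state_priority (qq i.+1)) \/
      [/\ children T (tt i) (tt i.+1), pr i.+1 = state_priority (qq i.+1) &
          exists o, label T (tt i.+1) = main_state (qq i.+1)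
            (min_priority (pr i) (state_priority (qq i.+1))) o]) ->
  (forall N, exists i, N <= size (tt i)) ->
  parity_condition (fun i => prio (qq i)).
Proof.
move=> Tacc ttnode tt0 pr0 step ttsize.
have ttpre i : take (size (tt i)) (tt i.+1) = tt i.
  have [[-> _]|[[_ [j ->]] _ _]] := step i; first by rewrite take_size.
  by rewrite -cats1 take_size_cat.
have ttS i : tt i.+1 = tt i \/ size (tt i.+1) = (size (tt i)).+1.
  have [[-> _]|[[_ [j ->]] _ _]] := step i; first by left.
  by right; rewrite size_rcons.
have ttmono i j : i <= j -> size (tt i) <= size (tt j).
  move=> /subnKC <-; elim: (j - i) => [|r IHr]; first by rewrite addn0.
  by rewrite addnS; case: (ttS (i + r)) => ->; lia.
have [b' hb'] := prefix_chain ttpre ttsize.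
have path' : infinite_path T b'.
  by move=> N; have [i hi] := ttsize N; rewrite -(hb' i) //; exact: take_node.
pose h j := nat_of_ord (sync_prio (label T (mkseq b' j))).
pose f i := prio (qq i).
(* Level [j] is left at some step [i] of A, and the main state then entered stores the minimum over
   the stay at that level, including the final [qq i.+1]. *)
have cross i0 j : size (tt i0) <= j -> exists2 i, i0 <= i &
    size (tt i) = j /\ h j.+1 = minn (pval (pr i)) (f i.+1).
  move=> i0j; have [m hm] := ttsize j.+1.
  have [i i0i /andP[ij ji]] : exists2 i, i0 <= i &
      size (tt i) <= j < size (tt i.+1).
    apply: (crossing (m := m) (g := fun i => size (tt i))) => //.
    by rewrite leqNgt; apply/negP => /ltnW /ttmono; lia.
  exists i => //; have [[tE _]|[[_ [l tE]] _ [of_ lE]]] := step i.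
    by rewrite tE in ji; lia.
  have szE : size (tt i.+1) = (size (tt i)).+1 by rewrite tE size_rcons.
  have jE : size (tt i) = j by lia.
  split=> //; rewrite /h -(hb' i.+1); last by lia.
  rewrite take_oversize; last by lia.
  by rewrite lE /= min_priorityE.
have prle i r : size (tt (i + r)) = size (tt i) -> pval (pr (i + r)) <= f i.
  elim: r => [_|r IHr].
    rewrite addn0; case: i => [|i]; first by rewrite pr0.
    by have [[_ ->]|[_ -> _]] := step i; rewrite ?min_priorityE ?geq_minr.
  rewrite addnS => sE; have s1 := ttmono i (i + r) (leq_addr _ _).
  have [[tE ->]|[[_ [l tE]] _ _]] := step (i + r).
    by rewrite min_priorityE geq_min IHr // -tE sE.
  by rewrite tE size_rcons in sE; lia.
(* Together with [prle]: [pr i] is attained during the current stay and bounds the priorities seen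
   so far in it. *)
have prex i : exists2 i', size (tt i') = size (tt i) & pval (pr i) = f i'.
  elim: i => [|i [i' sE prE]].
    by exists 0; rewrite ?pr0.
  have [[tE ->]|[_ -> _]] := step i; last by exists i.+1.
  rewrite min_priorityE; case: leqP => _; last by exists i.+1.
  by exists i' => //; rewrite tE.
apply: (dominated_parity (f := h)) (Tacc b' path').
+ move=> N; have [M hM] := ttsize N; exists M => i Mi.
  have [i' ii' [sE hE]] := cross i _ (leqnn _).
  exists (size (tt i)).+1.
    by have := ttmono _ _ Mi; lia.
  rewrite hE geq_min; have := prle i (i' - i).
  by rewrite subnKC // => ->.
(* The minimum stored at level [j.+1] comes from the stay at level [j], which lies after [N] once
   [j] exceeds [size (tt N)]; hence the shift by two. *)
+ move=> N; exists (size (tt N)).+2 => j; case: j => // j Nj.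
  have [|i _ [sE hE]] := cross 0 j; first by rewrite tt0.
  rewrite hE; case: (leqP (pval (pr i)) (f i.+1)) => _.
    have [i' s'E ->] := prex i; exists i' => //.
    by rewrite leqNgt; apply/negP => /ltnW /ttmono; lia.
  exists i.+1 => //; rewrite leqNgt; apply/negP => iN.
  by have := ttmono i N (ltnW (ltnW iN)); lia.
Qed.

(** A configuration consists of a node [t] of the given run and a stage of the play that the
    children of [t] support. Unravelling the plays step by step gives the run of A, with counters
    [size t + o e]. *)
Lemma sub_sync_language (w : nat -> n.-tuple Sigma) : 0 < n ->
  ap_language sync_apa w -> aa_sync_language A k w.
Proof.
move=> n0 [T hrun Tacc]; have [Tinit Trun] := hrun.
(* A filler label for the root, which is represented by [None]. *)
have [q0 _] : exists q0, q0 \in [set: aa_state A]%SET.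
  by apply/set0Pn; rewrite -card_gt0 cardsT aa_nonempty.
pose Y t := (label T @` children T t)%classic.
pose config : Type := seq nat * Q * used_priority * ('I_n -> nat).
pose inv (x : option config) := if x is Some (t, q, pr, o) then
  [/\ node T t, exists e, o e = 0, forall i j, o i <= o j + k &
      plays (w (size t)) (Y t) q pr o] else True.
pose lab (x : option config) := if x is Some (_, q, _, _) then q else q0.
pose cnt (x : option config) e :=
  if x is Some (t, _, _, o) then size t + o e else 0.
pose move (x : option config) (d : 'I_n) (X : set Q) :=
  (X !=set0)%classic /\
  if x is Some (t, q, pr, o) then
    [/\ forall i j, advance d o i <= advance d o j + k,
        satisfies X (aa_trans q (tnth (w (cnt x d)) d) d) &
        forall q', X q' -> plays (w (size t)) (Y t) q'
          (min_priority pr (state_priority q')) (advance d o)]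
  else satisfies X (aa_init A) /\
    forall q, X q -> plays (w 0) (Y [::]) q (state_priority q) (fun=> 0).
have move_ex x : inv x -> exists d X, move x d X.
  case: x => [[[[t q] pr] o]|] /=; last first.
    have [_] := Trun _ (node_nil T).
    rewrite Tinit => /satisfies_starts[X [X0 Xsat hX]] _.
    by exists (Ordinal n0), X.
  move=> [ht o0 osync hplay].
  have [d [b [X [h1 h2 h3 h4 h5]]]] := plays_first_step hplay o0.
  exists d, X; split=> //; split=> //.
  (* The guess is correct: either it was compared with the current letter, or a child of [t] carries
     the claim and [check_run] applies. *)
  suff -> : tnth (w (size t + o d)) d = b by [].
  case E: (o d) h2 => [|j]; first by rewrite addn0.
  move=> [j' j'E [s [hs [i sE]] ls]].
  by rewrite -(check_run hrun hs ls) sE size_rcons j'E addSnnS.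
have /boolp.choice[D hD] : forall x, exists d, inv x -> exists X, move x d X.
  move=> x; case: (pselect (inv x)) => [/move_ex[d hd]|nx].
    by exists d.
  by exists (Ordinal n0) => /nx.
have /boolp.choice[X hX] : forall x, exists X, inv x -> move x (D x) X.
  move=> x; case: (pselect (inv x)) => [/hD[X hX]|nx].
    by exists X.
  by exists set0%classic => /nx.
pose next (x : option config) (q' : Q) (y : option config) :=
  if x is Some (t, q, pr, o) then
    if y is Some (t', q'', pr', o') then
      [/\ q'' = q', forall e, size t' + o' e = size t + advance (D x) o e &
          t' = t /\ pr' = min_priority pr (state_priority q') \/
          [/\ children T t t', pr' = state_priority q' &
              exists of_, label T t' =
                main_state q' (min_priority pr (state_priority q')) of_]]
    else False
  else y = Some ([::], q', state_priority q', fun=> 0).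
pose succ x y := exists2 q', X x q' & inv y /\ next x q' y.
have next_ex x q' : inv x -> X x q' -> exists2 y, inv y & next x q' y.
  move=> ix Xq'; have := hX x ix.
  case: x ix Xq' => [[[[t q] pr] o]|] ix Xq' [_] /=; last first.
    move=> [_ /(_ _ Xq') hplay].
    exists (Some ([::], q', state_priority q', fun=> 0)) => //=.
    by split=> //; [exact: node_nil|exists (Ordinal n0)].
  set d := D _ => -[h1 _ /(_ _ Xq') hplay].
  have [ht [e0 oe0] osync _] := ix.
  (* With an offset still zero the play stays at [t]. Otherwise position [size t] is finished, and
     the play moves to the child with the waiting main state while all offsets drop by one. *)
  case: (pselect (exists e, advance d o e = 0)) => [hz|/forallNP hz].
    exists (Some (t, q', min_priority pr (state_priority q'), advance d o)).
      by [].
    by split=> //; left.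
  have o_gt0 e : 0 < advance d o e by have := hz e; lia.
  have [t' ht' lt'] := plays_waits hplay o_gt0.
  have [ht1 [j t'E]] := ht'.
  have oe1 : advance d o e0 = 1.
    by have := o_gt0 e0; rewrite /advance oe0; case: eqP.
  (* The smallest offset is now 1, so the decreased offsets are at most [k] and [main_state] stores
     them faithfully. *)
  have osmall e : (advance d o e).-1 <= k by have := h1 e e0; rewrite oe1; lia.
  exists (Some (t', q', state_priority q', fun e => (advance d o e).-1)) => /=.
    split=> //.
    - by exists e0; rewrite oe1.
    - by move=> i i'; have := h1 i i'; have := o_gt0 i; have := o_gt0 i'; lia.
    - have [_] := Trun _ ht1; rewrite lt' /= => /satisfies_plays.
      congr (plays _ _ _ _ _); apply/funext => e.
      by rewrite ffunE inordK //; exact: osmall.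
  split=> //.
    by move=> e; rewrite t'E size_rcons; have := o_gt0 e; lia.
  by right; split=> //; eexists; exact: lt'.
have succ_inv x y : inv x -> succ x y -> inv y by move=> _ [q' _ []].
have succ_lab x y q' : next x q' y -> lab y = q'.
  case: x => [[[[t q] pr] o]|] /=; last by move=> ->.
  by case: y => [[[[t' q''] pr'] o']|] // [].
have succ_labs x : inv x -> (lab @` succ x)%classic = X x.
  move=> ix; apply/seteqP; split=> [q [y [q' Xq' [_ /succ_lab ->]] <-//]|q Xq].
  have [y iy hy] := next_ex x q ix Xq.
  by exists y; [exists q|exact: succ_lab hy].
have succ_ex x : inv x -> exists y, succ x y.
  move=> ix; have [[q' Xq'] _] := hX x ix.
  have [y iy hy] := next_ex x q' ix Xq'.
  by exists y, q'.
have [T' [pos [pos0 hT' psucc plab pcard]]] :=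
  unravelling lab (I : inv None) succ_inv succ_ex.
have posS t j : node T' (rcons t j) -> succ (pos t) (pos (rcons t j)).
  by move=> h; apply: psucc; split=> //; exists j.
have posSome t : node T' t -> t <> [::] -> exists z, pos t = Some z.
  case/lastP: t => // t j /posS[q' _ [_]] + _; rewrite /next.
  case: (pos t) => [[[[? ?] ?] ?]|]; last by move=> ->; eexists.
  by case: (pos _) => // z _; exists z.
exists T', (fun t => cnt (pos t)); split.
- split.
  + move=> t ht st e; case/lastP: t ht st => [|t j] ht; first by rewrite pos0.
    rewrite size_rcons ltnS leqn0 size_eq0 => /eqP t0; rewrite t0 in ht *.
    by have [q' _ [_]] := posS _ _ ht; rewrite pos0 /= => ->.
  + rewrite plab; last exact: node_nil.
    by rewrite pos0 succ_labs //; have [_ []] := hX None I.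
  + move=> t ht tn; exists (D (pos t)).
    have cS s e : children T' t s ->
        cnt (pos s) e = cnt (pos t) e + (e == D (pos t)).
      move=> [hs [j sE]]; rewrite sE in hs *.
      have [q' _ [_]] := posS _ _ hs; have [z] := posSome t ht tn.
      move: z => [[[t1 q] pr] o] -> /=.
      case: (pos _) => [[[[t' q''] pr'] o']|] //= [_ -> _].
      by rewrite /advance addnA.
    split.
    * by move=> s hs; rewrite cS // eqxx addn1.
    * by move=> s hs d' /eqP /negPf dd; rewrite cS // dd addn0.
    * exact: pcard.
    * have [ip ->] := hT' t ht; rewrite plab // succ_labs //.
      have [z zE] := posSome t ht tn; have [_] := hX _ ip.
      by rewrite zE; move: z {zE} => [[[t1 q] pr] o] [].
- move=> b hb.
  have posbS i : succ (pos (mkseq b i)) (pos (mkseq b i.+1)).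
    by rewrite mkseqS; apply: posS; rewrite -mkseqS; exact: hb.
  have /boolp.choice[z hz] : forall i, exists z, pos (mkseq b i.+1) = Some z.
    by move=> i; apply: posSome (hb _) _; rewrite mkseqS; case: (mkseq b i).
  pose tt i := (z i).1.1.1.
  pose qq i := (z i).1.1.2.
  pose pr i := (z i).1.2.
  have zE i : z i = (tt i, qq i, pr i, (z i).2).
    by rewrite /tt /qq /pr; case: (z i) => [[[]]].
  have zinv i : inv (Some (z i)) by rewrite -hz; have [] := hT' _ (hb i.+1).
  have znext i : (forall e, cnt (Some (z i.+1)) e =
         cnt (Some (z i)) e + (e == D (Some (z i)))) /\
      (tt i.+1 = tt i /\
       pr i.+1 = min_priority (pr i) (state_priority (qq i.+1)) \/
       [/\ children T (tt i) (tt i.+1), pr i.+1 = state_priority (qq i.+1) &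
           exists of_, label T (tt i.+1) = main_state (qq i.+1)
             (min_priority (pr i) (state_priority (qq i.+1))) of_]).
    have [q' _ [_]] := posbS i.+1; rewrite !hz (zE i.+1) (zE i) /=.
    move=> [-> hc h]; split=> // e; by rewrite hc /advance addnA.
  have labE i : label T' (mkseq b i.+1) = qq i.
    by have [_ ->] := hT' _ (hb i.+1); rewrite hz zE.
  have sumcnt i : i <= \sum_(e < n) cnt (Some (z i)) e.
    elim: i => // i IHi; have [hc _] := znext i.
    under eq_bigr do rewrite hc.
    rewrite big_split /= [X in _ + X](bigD1 (D (Some (z i)))) //= eqxx.
    by rewrite addnCA add1n ltnS (leq_trans IHi) // leq_addr.
  have ttsize N : exists i, N <= size (tt i).
    (* Every step raises the sum of the counters by one, and synchrony bounds each counter by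
       [size (tt i) + k]. So after [n * (N + k)] steps level [N] has been reached. *)
    exists (n * (N + k)); apply: contraT; rewrite -ltnNge => hlt.
    have := sumcnt (n * (N + k)).
    set i := n * (N + k) in hlt *.
    have hle : \sum_(e < n) cnt (Some (z i)) e <= n * (size (tt i) + k).
      rewrite -[n in leqRHS]card_ord -sum_nat_const; apply: leq_sum => e _.
      have := zinv i; rewrite zE /= => -[_ [e0 oe0] osync _].
      by have := osync e e0; lia.
    move=> /leq_trans /(_ hle); rewrite {1}/i leq_pmul2l //.
    by lia.
  have ttnode i : node T (tt i) by have := zinv i; rewrite zE => -[].
  have [tt0 pr0] : tt 0 = [::] /\ pr 0 = state_priority (qq 0).
    by have [q' _ [_]] := posbS 0; rewrite pos0 hz /= /tt /pr /qq => -[->].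
  (* Drops the root and its filler label. *)
  apply/(parity_condition_shift 1).
  under [X in parity_condition X]funext do rewrite add1n labE.
  apply: segment_minima_parity Tacc ttnode tt0 pr0 _ ttsize => i.
  by have [_] := znext i.
- move=> t ht i j; have [+ _] := hT' t ht.
  case: (pos t) => [[[[t' q] pr] o]|] /=; last by [].
  by move=> [_ _ osync _]; have := osync i j; have := osync j i; lia.
Qed.

Lemma sync_languageE : 0 < n -> ap_language sync_apa = aa_sync_language A k.
Proof.
move=> n0; apply/seteqP; split=> w; [exact: sub_sync_language|].
exact: sync_language_sub.
Qed.

(** * Counting the states *)

Lemma card_sync_state :
  #|sync_state| =
    2 + #|aa_state A| * aa_num_prios A * k.+1 ^ n + n * k * #|Sigma|.
Proof.
rewrite !card_sum !card_prod card_ffun !card_ord card_bool card_sig.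
by rewrite /aa_num_prios; congr (_ + _ * _ * _ + _); apply: eq_card.
Qed.

End SynchronousAutomaton.

Lemma aa_num_prios_gt0 (Sigma : finType) (n : nat) (A : AAPA Sigma n) :
  0 < aa_num_prios A.
Proof.
have /card_gt0P[q _] := aa_nonempty A.
by apply/card_gt0P; exists (aa_prio q); exact: codom_f.
Qed.

(** The main states and the checks each fit once into the product, and the two extra states fit
    twice, since the product is positive; hence the factor 4. *)
Lemma card_sync_state_le (Sigma : finType) (n k : nat) (A : AAPA Sigma n) :
  1 < #|Sigma| ->
  #|sync_state k A| <=
    4 * (aa_num_prios A * #|aa_state A| * #|Sigma| ^ (k * n)).
Proof.
move=> s1; rewrite card_sync_state.
have lm0 : 0 < aa_num_prios A * #|aa_state A|.
  by rewrite muln_gt0 aa_num_prios_gt0 aa_nonempty.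
have sx0 : 0 < #|Sigma| ^ (k * n) by rewrite expn_gt0; lia.
have h1 : k.+1 ^ n <= #|Sigma| ^ (k * n).
  rewrite expnM; case: n {A lm0 sx0} => // n'.
  by rewrite leq_exp2r // ltn_expl.
have h2 : n * k * #|Sigma| <= #|Sigma| ^ (k * n).
  rewrite [n * k]mulnC; case: (k * n) => [|x]; first by rewrite mul0n.
  by rewrite expnSr leq_mul2r ltn_expl ?orbT.
have h3 : #|aa_state A| * aa_num_prios A * k.+1 ^ n <=
    aa_num_prios A * #|aa_state A| * #|Sigma| ^ (k * n).
  by rewrite [_ * aa_num_prios A]mulnC leq_mul2l h1 orbT.
have h4 : #|Sigma| ^ (k * n) <=
    aa_num_prios A * #|aa_state A| * #|Sigma| ^ (k * n).
  by rewrite leq_pmull.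
by move: h2 h3 h4 sx0; lia.
Qed.

(** * One-state automata and the final case distinction *)

Definition accept_all_apa (Gamma : finType) : APA Gamma :=
  @MkAPA Gamma unit tt (fun _ _ => PAtom tt) 0 (fun=> ord0).

Definition reject_all_apa (Gamma : finType) : APA Gamma :=
  @MkAPA Gamma unit tt (fun _ _ => PFalse) 0 (fun=> ord0).

Lemma accept_all_language (Gamma : finType) :
  ap_language (accept_all_apa Gamma) = setT.
Proof.
apply/seteqP; split=> // w _.
have [] := @unravelling unit unit tt id (fun _ _ => True) (fun=> True) I.
- by [].
- by move=> x _; exists tt.
move=> T [pos [_ _ _ hT Tcard]]; exists T.
  split=> [|t ht]; first by case: (label _ _).
  split; first exact: Tcard.
  suff : (label T @` children T t)%classic tt by [].
  by rewrite hT //; exists tt.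
by move=> b _; exists 0; split=> // N; exists N.
Qed.

Lemma reject_all_language (Gamma : finType) :
  ap_language (reject_all_apa Gamma) = set0.
Proof.
by apply/seteqP; split=> // w [T [_ hT] _]; have [_] := hT _ (node_nil T).
Qed.

Theorem theorem3p11 :
  exists C : nat,
  forall (k : nat) (Sigma : finType) (hSigma : 0 < #|Sigma|) (n l m : nat)
    (A : AAPA Sigma n) (hl : aa_num_prios A = l) (hm : #|aa_state A| = m),
  exists B : APA (n.-tuple Sigma),
    #|ap_state B| <= C * (l * m * #|Sigma| ^ (k * n)) /\
    ap_language B = aa_sync_language A k.
Proof.
exists 4 => k Sigma hSigma n l m A <- <-.
(* More than one tuple forces both [0 < n] and [1 < #|Sigma|]. With a single letter the required
   bound would not grow with [k], unlike [(k+1)^n] for positive [n]. *)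
have [one|many] := leqP #|{: n.-tuple Sigma}| 1; last first.
  have n0 : 0 < n.
    by rewrite lt0n; apply: contraTneq many => ->; rewrite card_tuple.
  exists (sync_apa k A); split; last exact: sync_languageE.
  apply: card_sync_state_le; rewrite ltnNge; apply: contraTN many => s1.
  by rewrite card_tuple -leqNgt -(exp1n n) leq_exp2r.
have wordE (w w' : nat -> n.-tuple Sigma) : w = w'.
  by apply/funext => i; exact: (fintype_le1P one).
have size1 : #|{: unit}| <=
    4 * (aa_num_prios A * #|aa_state A| * #|Sigma| ^ (k * n)).
  by rewrite card_unit !muln_gt0 aa_num_prios_gt0 aa_nonempty expn_gt0 hSigma.
case: (pselect (exists w, aa_sync_language A k w)) => [[w hw]|/forallNP nw].
  exists (accept_all_apa _); split=> //; rewrite accept_all_language.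
  by apply/seteqP; split=> // w' _; rewrite (wordE w' w).
exists (reject_all_apa _); split=> //; rewrite reject_all_language.
by apply/seteqP; split=> // w' /nw.
Qed.
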